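(* Let $h\ge 3$. (1) For every $m\ge 5$ with $h<|T(m)|$, the puzzle graph $puz[T(h;m)]$ of the triangular board with $m$ hexagons on a side and $h$ holes is maximally connected. (2) For every $m\ge 3$ with $h<|F(m)|$, the puzzle graph $puz[F(h;m)]$ of the flower (hexagon-shaped) board with $m$ hexagons on a side and $h$ holes is maximally connected.
   Context: Hexagons of the regular hexagonal tessellation of the plane are identified with points of $\mathbb{Z}^2$; two hexagons are adjacent (share an edge) iff their difference is one of $\pm(1,0),\pm(0,1),\pm(1,1)$. A board $B$ is a finite set of hexagons (positions). The triangular board with $m$ hexagons on a side is $T(m)=\{(i,j)\in\mathbb{Z}^2: 0\le j\le i\le m-1\}$. The flower board with $m$ layers (a hexagon with $m$ hexagons on a side, consisting of concentric rings around a central hexagon) is $F(m)=\{(i,j)\in\mathbb{Z}^2:\max(|i|,|j|,|i-j|)\le m-1\}$. $B(h)$ denotes the board $B$ with $h$ holes: a configuration of $B(h)$ is a placement of $t=|B|-h$ tiles with distinct labels $1,\dots,t$ on distinct positions of $B$; the $h$ unoccupied positions are the holes (unlabeled; adjacent holes are counted separately). A slide moves a tile from its position $p$ to a hole $q$ adjacent to $p$, and is permitted iff there is another hole $r$ that is adjacent to both $p$ and $q$. The puzzle graph $puz[B(h)]$ has the configurations of $B(h)$ as vertices, with an edge between two configurations whenever one can be obtained from the other by one slide. A configuration is non-isolated if at least one slide is possible from it. $puz[B(h)]$ is maximally connected if there is at least one non-isolated configuration and all non-isolated configurations lie in a single connected component. $T(h;m)$ and $F(h;m)$ are the boards $T(m)$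 and $F(m)$ with $h$ holes. *)

(* Defs.v *)
From HB Require Import structures.
From mathcomp Require Import all_boot all_order all_algebra.
From mathcomp Require Import finmap.
Set Implicit Arguments.
Unset Strict Implicit.
Unset Printing Implicit Defensive.
Import Order.TTheory GRing.Theory Num.Theory.

Local Open Scope fset_scope.
Local Open Scope ring_scope.

Notation hexagon := (int * int)%type.

Definition hex_adj (p q : hexagon) : bool :=
  (p - q) \in [:: (1, 0); (-1, 0); (0, 1); (0, -1); (1, 1); (-1, -1)].

Notation board := {fset hexagon}.

(* An auxiliary finite square containing the boards below; it only serves to
   carve them out by a separation, see in_triangle and in_flower. *)
Definition square (n : nat) : board :=
  [fset (i%:Z - n%:Z, j%:Z - n%:Z) | i in iota 0 n.*2.+1, j in iota 0 n.*2.+1].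

Definition triangle (m : nat) : board :=
  [fset p in square m | (0 <= p.2) && (p.2 <= p.1) && (p.1 <= m%:Z - 1)].

Definition flower (m : nat) : board :=
  [fset p in square m |
    Num.max (Num.max `|p.1| `|p.2|) `|p.1 - p.2| <= m%:Z - 1].

Lemma in_square n p : (p \in square n) = (`|p.1| <= n%:Z) && (`|p.2| <= n%:Z).
Proof.
have E (x : int) : `|x| <= n%:Z ->
    (`|(x + n%:Z)%R|%N%:Z - n%:Z = x) /\ `|(x + n%:Z)%R|%N \in iota 0 n.*2.+1.
  move=> xn; have x0 : 0 <= x + n%:Z.
    by rewrite -lerBlDr sub0r; move: xn; rewrite ler_norml => /andP[].
  split; first by rewrite gez0_abs // addrK.
  rewrite mem_iota add0n leq0n /= ltnS -lez_nat gez0_abs // -addnn PoszD lerD2r.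
  by move: xn; rewrite ler_norml => /andP[].
have E' i : i \in iota 0 n.*2.+1 -> `|i%:Z - n%:Z| <= n%:Z.
  rewrite mem_iota add0n /= ltnS => hi.
  by rewrite ler_norml lerBrDr addNr lerBlDr -PoszD addnn !lez_nat hi.
apply/imfset2P/andP => [[i /= hi [j /= hj ->]]|[h1 h2]] /=.
  by split; exact: E'.
have [e1 m1] := E _ h1; have [e2 m2] := E _ h2.
exists `|(p.1 + n%:Z)%R|%N => //; exists `|(p.2 + n%:Z)%R|%N => //.
by rewrite e1 e2 -surjective_pairing.
Qed.

Lemma in_triangle m i j :
  ((i, j) \in triangle m) = (0 <= j) && (j <= i) && (i <= m%:Z - 1).
Proof.
rewrite !inE /= in_square /=; apply: andb_idl => /andP[/andP[j0 ji] im].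
have im' : i <= m%:Z by apply: le_trans im _; rewrite gerBl.
by rewrite !ger0_norm ?im' ?(le_trans ji) // (le_trans j0).
Qed.

Lemma in_flower m i j :
  ((i, j) \in flower m) =
  (Num.max (Num.max `|i| `|j|) `|i - j| <= m%:Z - 1).
Proof.
rewrite !inE /= in_square /=; apply: andb_idl.
by rewrite !ge_max => /andP[/andP[i1 j1] _]; apply/andP; split;
  [apply: le_trans i1 _|apply: le_trans j1 _]; rewrite gerBl.
Qed.

(* Tiles are numbered from 0; c a is the position of the tile a. *)
Definition config (B : board) (h : nat) : finType :=
  {c : {ffun 'I_(#|` B| - h) -> B} | injectiveb c}.

Definition pos (B : board) (h : nat) (c : config B h)
  (a : 'I_(#|` B| - h)) : B := val c a.

Definition is_hole (B : board) (h : nat) (c : config B h) (q : B) : bool :=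
  [forall a, pos c a != q].

Definition slide_permitted (B : board) (h : nat) (c : config B h)
    (a : 'I_(#|` B| - h)) (q : B) : bool :=
  [&& is_hole c q, hex_adj (val (pos c a)) (val q) &
    [exists r : B, [&& r != q, is_hole c r,
                       hex_adj (val r) (val (pos c a)) &
                       hex_adj (val r) (val q)]]].

Definition slide (B : board) (h : nat) (c d : config B h) : bool :=
  [exists a, [exists q : B, [&& slide_permitted c a q, pos d a == q &
                             [forall b, (b != a) ==> (pos d b == pos c b)]]]].

Definition puz (B : board) (h : nat) : rel (config B h) :=
  fun c d => slide c d || slide d c.

Definition non_isolated (B : board) (h : nat) (c : config B h) : bool :=
  [exists a, [exists q : B, slide_permitted c a q]].

Definition maximally_connected (B : board) (h : nat) : Prop :=
  (exists c : config B h, non_isolated c) /\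
  (forall c d : config B h,
     non_isolated c -> non_isolated d -> connect (@puz B h) c d).

(* Main.v *)
Require Import Defs.
From mathcomp Require Import all_boot all_order all_algebra.
From mathcomp Require Import finmap.
From mathcomp Require Import zify.

(** With three holes, two of them adjacent, the tiles of a large enough board
    can be permuted at will. The proof reduces everything to one board of eight
    cells by a gluing argument.

    More than three holes reduce to three: all holes but three, chosen so that
    two of them are adjacent, are regarded as further tiles, all with the same
    label. Sliding such a tile changes nothing in the actual configuration, so a
    walk with three holes yields a walk in the puzzle graph
    ([reach_connect]).

    Call a board mobile when any two arrangements of the same contents with
    three holes, two of them adjacent, are joined by slides, and when a pair of
    adjacent holes can be moved to any edge ([mobile]). If two mobile boards
    share four cells, two of which are adjacent, and every edge of their union
    lies in a triangle of the union, then the union is mobile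
    ([mobile_union]): park the holes on three common cells; an exchange of the
    fourth common cell with any other cell takes place inside one of the two
    boards; these exchanges generate all permutations. The third hole may be far
    from the first two, and this is where moving a pair of holes is used.

    The seed is the flower with two layers plus one cell on an edge of its ring,
    the ear ([mobile_eared]); the flower with two layers alone is not mobile. Two explicit
    sequences of slides and their mirror images exchange the ear's tile with
    each of the others, and a search over the positions of the holes shows that
    they can always be parked.

    Mobility is invariant under the translations and rotations of the lattice.
    Three rotated copies of the seed form the triangle of side 4, and three
    translates of a triangle form the next one. Two copies of the seed form the
    union of two overlapping flowers, and successive unions with translates
    turn this board into every flower with at least three layers. *)

Set Implicit Arguments.
Unset Strict Implicit.
Unset Printing Implicit Defensive.
Import Order.TTheory GRing.Theory Num.Theory.
Local Open Scope ring_scope.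

Implicit Types (p q r u x y z : hexagon) (B C U Z : seq hexagon).

(** * The lattice and the exchange of two cells *)

Lemma hex_adjE p q : hex_adj p q =
  [|| (p.1 == q.1 + 1) && (p.2 == q.2), (p.1 + 1 == q.1) && (p.2 == q.2),
      (p.1 == q.1) && (p.2 == q.2 + 1), (p.1 == q.1) && (p.2 + 1 == q.2),
      (p.1 == q.1 + 1) && (p.2 == q.2 + 1) |
      (p.1 + 1 == q.1) && (p.2 + 1 == q.2)].
Proof.
case: p q => [i j] [k l]; rewrite /hex_adj !inE.
have -> : (i, j) - (k, l) = (i - k, j - l) :> hexagon by [].
rewrite !xpair_eqE /=; lia.
Qed.

Lemma hex_adjC p q : hex_adj p q = hex_adj q p.
Proof. by rewrite !hex_adjE; lia. Qed.

Lemma hex_adj_neq p q : hex_adj p q -> p != q.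
Proof. by case: p q => [i j] [k l]; rewrite hex_adjE xpair_eqE /=; lia. Qed.

Definition exch p q u : hexagon := if u == p then q else if u == q then p else u.

Lemma exchl p q : exch p q p = q. Proof. by rewrite /exch eqxx. Qed.

Lemma exchr p q : exch p q q = p.
Proof. by rewrite /exch eqxx; case: eqP. Qed.

Lemma exch_id p q u : u != p -> u != q -> exch p q u = u.
Proof. by rewrite /exch => /negPf-> /negPf->. Qed.

Lemma exchK p q : involutive (exch p q).
Proof.
move=> u; rewrite {2}/exch; case: eqP => [->|/eqP up]; first exact: exchr.
by case: eqP => [->|/eqP uq]; rewrite ?exchl ?exch_id.
Qed.

Lemma exchC p q : exch p q =1 exch q p.
Proof. by move=> u; rewrite /exch; do 2!case: eqP => // [->]. Qed.

Lemma exch_mem B p q u : p \in B -> q \in B -> (exch p q u \in B) = (u \in B).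
Proof.
by move=> pB qB; rewrite /exch; case: eqP => [->|_]; [rewrite pB|case: eqP => // ->; rewrite pB].
Qed.

Lemma perm_exch B p q : uniq B -> p \in B -> q \in B ->
  perm_eq (map (exch p q) B) B.
Proof.
move=> uB pB qB; apply: uniq_perm => //; first by rewrite (map_inj_uniq (inv_inj (exchK p q))).
by move=> u; rewrite -{1}[u](exchK p q) (mem_map (inv_inj (exchK p q))) exch_mem.
Qed.

Definition tri p q r := [&& hex_adj p q, hex_adj p r & hex_adj q r].

(** * Slides of states *)

Definition state := hexagon -> nat.
Implicit Types (s t : state).

(** A state reads 0 at a hole. A slide exchanges the contents of [p] and of the
    hole [q]; when [p] is a hole too nothing changes, and admitting this case
    saves a side condition on [p]. States are compared on the
    board only, since the outside is irrelevant. *)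
Inductive reach B : state -> state -> Prop :=
| reach_refl s t : {in B, s =1 t} -> reach B s t
| reach_slide s t p q r : [/\ p \in B, q \in B & r \in B] -> tri p q r ->
    s q = 0%N -> s r = 0%N -> reach B (s \o exch p q) t -> reach B s t.

Lemma reach_eql B s s' t : {in B, s =1 s'} -> reach B s' t -> reach B s t.
Proof.
move=> ss' R; elim: R s ss' => {s' t} [s' t st|s' t p q r [pB qB rB] tr sq sr _ IH] s ss'.
  by apply: reach_refl => u uB; rewrite ss' ?st.
apply: (@reach_slide _ _ _ p q r) => //; rewrite ?ss' //.
by apply: IH => u uB /=; rewrite ss' ?exch_mem.
Qed.

Lemma reach_trans B s t w : reach B s t -> reach B t w -> reach B s w.
Proof.
move=> R; elim: R => {s t} [s t st|s t p q r pqr tr sq sr _ IH] Rw; first exact: reach_eql Rw.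
by apply: (reach_slide pqr tr) => //; exact: IH.
Qed.

(** After a slide from [p] to [q] the new hole [p] and the witness [r] allow the
    tile to slide back. *)
Lemma reach_sym B s t : reach B s t -> reach B t s.
Proof.
move=> R; elim: R => {s t} [s t st|s t p q r [pB qB rB] /and3P[pq pr qr] sq sr _ IH].
  by apply: reach_refl => u uB; rewrite st.
apply: reach_trans IH _; apply: (@reach_slide _ _ _ q p r) => //=.
- by rewrite /tri hex_adjC pq qr pr.
- by rewrite exchl.
- by rewrite exch_id // eq_sym hex_adj_neq.
- by apply: reach_refl => u uB /=; rewrite -exchC exchK.
Qed.

Lemma perm_map_exch B s p q : uniq B -> p \in B -> q \in B ->
  perm_eq (map (s \o exch p q) B) (map s B).
Proof. by move=> uB pB qB; rewrite map_comp perm_map ?perm_exch. Qed.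

Lemma reach_perm B s t : uniq B -> reach B s t -> perm_eq (map s B) (map t B).
Proof.
move=> uB; elim=> {s t} [s t st|s t p q r [pB qB rB] _ _ _ _ IH].
  by have /eq_in_map-> := st.
by apply: perm_trans IH; rewrite perm_sym perm_map_exch.
Qed.

Lemma reach_sub B U s t : {subset B <= U} -> reach B s t ->
  (forall u, u \notin B -> t u = s u) -> reach U s t.
Proof.
move=> BU R; elim: R => {s t} [s t st|s t p q r [pB qB rB] tr sq sr _ IH] out.
  by apply: reach_refl => u _; case: (boolP (u \in B)) => [/st|/out].
apply: (@reach_slide _ _ _ p q r) => //; first by split; exact: BU.
apply: IH => u uB /=; rewrite exch_id ?out //; apply: contraNneq uB => -> //.
Qed.

Definition empty_on Z s := {in Z, forall u, s u = 0%N}.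

Definition leads B Z Z' := forall s, empty_on Z s ->
  exists2 t, reach B s t & empty_on Z' t.

Lemma leads_refl B Z Z' : {subset Z' <= Z} -> leads B Z Z'.
Proof.
move=> ZZ s s0; exists s; first exact: reach_refl.
by move=> u /ZZ; exact: s0.
Qed.

Lemma leads_trans B Z1 Z2 Z3 : leads B Z1 Z2 -> leads B Z2 Z3 -> leads B Z1 Z3.
Proof.
move=> L1 L2 s /L1[t Rt /L2[w Rw w0]]; exists w => //; exact: reach_trans Rw.
Qed.

(** A walk on [B] leaves [t] undetermined outside [B]; seen in [U], it ends in
    the state corrected to [s] there. *)
Lemma reach_patch B U s t : {subset B <= U} -> reach B s t ->
  reach U s (fun u => if u \in B then t u else s u).
Proof.
move=> BU R; apply: (reach_sub BU); last by move=> u /negPf->.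
by apply: reach_trans R _; apply: reach_refl => u ->.
Qed.

Lemma leads_sub B U Z Z' : {subset B <= U} -> {subset Z' <= B} ->
  leads B Z Z' -> leads U Z Z'.
Proof.
move=> BU ZB L s /L[t /(reach_patch BU) R t0]; eexists; first exact: R.
by move=> u uZ /=; rewrite ZB // t0.
Qed.

Lemma leads_slide B p q r Z : [/\ p \in B, q \in B & r \in B] -> tri p q r ->
  q \in Z -> r \in Z -> leads B Z (map (exch p q) Z).
Proof.
move=> pqr tr qZ rZ s s0; exists (s \o exch p q).
  by apply: (reach_slide pqr tr); rewrite ?s0 //; exact: reach_refl.
by move=> _ /mapP[u uZ ->] /=; rewrite exchK s0.
Qed.

(** * Solvable boards *)

(** A pair of adjacent holes can be brought to any other edge of the board,
    whatever the tiles; this serves to fetch a distant third hole. *)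
Definition edge_mobile B := forall p q p' q',
  [/\ p \in B, q \in B & hex_adj p q] -> [/\ p' \in B, q' \in B & hex_adj p' q'] ->
  leads B [:: p; q] [:: p'; q'].

Definition three_holes B s := count_mem 0%N (map s B) = 3%N.

Definition adjacent_holes B s := exists p q,
  [/\ p \in B, q \in B, hex_adj p q, s p = 0%N & s q = 0%N].

(** Contents may repeat, so [s] and [t] are compared as multisets. Repetitions
    are what lets one value stand for all the holes beyond the third. Asking
    only for two adjacent holes, rather than for a possible slide, makes the
    property easier to use along an induction. *)
Definition solvable B := forall s t, three_holes B s ->
  perm_eq (map s B) (map t B) ->
  adjacent_holes B s -> adjacent_holes B t -> reach B s t.

Lemma three_holes_perm B s t : perm_eq (map s B) (map t B) ->
  three_holes B s -> three_holes B t.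
Proof. by move=> /permP e; rewrite /three_holes e. Qed.

Lemma three_holesE B s : three_holes B s <-> size [seq u <- B | s u == 0%N] = 3%N.
Proof. by rewrite /three_holes count_map size_filter. Qed.

(** The holes of [B] are among the three of [U], and [Z] shows that none of these
    is missing. *)
Lemma three_holes_sub B U Z s : uniq B -> uniq U -> {subset B <= U} ->
  uniq Z -> size Z = 3%N -> {subset Z <= B} -> empty_on Z s ->
  three_holes U s -> three_holes B s.
Proof.
move=> uB uU BU uZ zZ ZB s0 /three_holesE U3; apply/three_holesE/eqP.
rewrite eqn_leq -{1}U3 -zZ !uniq_leq_size ?filter_uniq // => u.
  by move=> uZ'; rewrite mem_filter ZB // s0.
by rewrite !mem_filter => /andP[-> /BU].
Qed.

(** The transpositions that involve a fixed cell [y] generate the symmetric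
    group. Hence, once the holes can be parked on [Z], exchanging the tile of
    [y] with any other tile is enough to sort the tiles. *)
Lemma star_solvable B Z y : uniq B -> uniq Z -> {subset Z <= B} ->
  y \in B -> y \notin Z ->
  (forall s, three_holes B s -> adjacent_holes B s ->
     exists2 t, reach B s t & empty_on Z t) ->
  (forall s p, three_holes B s -> empty_on Z s -> p \in B -> p \notin Z ->
     p != y -> reach B s (s \o exch y p)) ->
  solvable B.
Proof.
move=> uB uZ ZB yB yZ norm star s0 t0 three st ds dt.
have [s Rs sZ] := norm _ three ds.
have [t Rt tZ] := norm _ (three_holes_perm st three) dt.
apply: (reach_trans Rs); apply: reach_trans (reach_sym Rt).
have {}three : three_holes B s := three_holes_perm (reach_perm uB Rs) three.
have {}st : perm_eq (map s B) (map t B).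
  apply: perm_trans (reach_perm uB Rt); apply: perm_trans st.
  by rewrite perm_sym reach_perm.
clear s0 t0 Rs Rt ds dt norm.
(* The cell c receives its tile through y: first bring the tile from p to y,
   then exchange y and c; c is not touched again. *)
have sort Q : uniq (y :: Q) -> {subset Q <= [predD B & Z]} ->
    forall s, three_holes B s -> empty_on Z s ->
      perm_eq (map s (y :: Q)) (map t (y :: Q)) ->
    exists2 s', reach B s s' & {in y :: Q, s' =1 t} /\
      {in [predC y :: Q], s' =1 s}.
  elim: Q => [|c Q IH] uQ QB {three sZ st}s three sZ st.
    exists s; first exact: reach_refl.
    split => // u; rewrite inE => /eqP->.
    by have := perm_mem st (s y); rewrite !inE eqxx => /esym/eqP.
  have [p pQ tc] : exists2 p, p \in [:: y, c & Q] & t c = s p.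
    by apply/mapP; rewrite (perm_mem st) map_f // !inE eqxx orbT.
  have inB u : u \in [:: y, c & Q] -> (u \in B) && (u \notin Z).
    by rewrite inE => /orP[/eqP->|/QB]; rewrite ?yB ?inE // andbC.
  have {}star s1 p1 : three_holes B s1 -> empty_on Z s1 -> p1 \in [:: y, c & Q] ->
      [/\ reach B s1 (s1 \o exch y p1), three_holes B (s1 \o exch y p1),
          empty_on Z (s1 \o exch y p1) &
          perm_eq (map (s1 \o exch y p1) [:: y, c & Q]) (map s1 [:: y, c & Q])].
    move=> h3 h0 /[dup] p1Q /inB/andP[p1B p1Z].
    have Py : perm_eq (map (s1 \o exch y p1) [:: y, c & Q]) (map s1 [:: y, c & Q]).
      by rewrite perm_map_exch // mem_head.
    split => //.
    - have [->|py] := eqVneq p1 y; last exact: star.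
      by apply: reach_refl => u _; rewrite /= /exch; case: eqP => // ->.
    - by apply: three_holes_perm h3; rewrite perm_sym perm_map_exch.
    - move=> u uZ' /=; rewrite exch_id ?h0 //.
        by apply: contraNneq yZ => <-.
      by apply: contraNneq p1Z => <-.
  have [R1 h1 z1 P1] := star _ _ three sZ pQ.
  have [|R2 h2 z2 P2] := star _ c h1 z1; first by rewrite !inE eqxx orbT.
  set s2 := (_ \o exch y c) in R2 h2 z2 P2.
  have s2c : s2 c = t c by rewrite /s2 /= exchr exchl tc.
  have [] := IH _ _ s2 h2 z2.
  - by move: uQ; rewrite /= inE negb_or -!andbA => /and4P[_ -> _ ->].
  - by move=> u uQ'; apply: QB; rewrite inE uQ' orbT.
  - have := perm_trans (perm_trans P2 P1) st; rewrite /= s2c.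
    rewrite -[s2 y :: _]/([:: s2 y] ++ _) -[t y :: _]/([:: t y] ++ _).
    rewrite (perm_catCA [:: s2 y] [:: t c]) perm_sym (perm_catCA [:: t y] [:: t c]).
    by rewrite perm_cons perm_sym.
  move=> s' R' [e1 e2]; exists s'.
    by apply: (reach_trans R1); apply: (reach_trans R2).
  have cy : c \notin y :: Q.
    by move: uQ; rewrite /= !inE !negb_or eq_sym -!andbA => /and4P[-> _ ->].
  split=> u.
    rewrite inE orbCA -in_cons => /orP[/eqP->|/e1//].
    by rewrite e2.
  rewrite inE /= inE orbCA negb_or -in_cons => /andP[uc uQ'].
  have uy : u != y by apply: contraNneq uQ' => ->; rewrite mem_head.
  have up : (u == p) = false.
    apply: contraNF uQ' => /eqP e; move: pQ; rewrite -e !inE.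
    by rewrite (negPf uc) (negPf uy).
  by rewrite e2 //= /s2 /= exch_id // exch_id // up.
pose Q := [seq u <- B | (u \notin Z) && (u != y)].
have BQ : perm_eq B (Z ++ y :: Q).
  apply: uniq_perm => //.
    rewrite cat_uniq uZ /= negb_or yZ filter_uniq // mem_filter eqxx andbF /= andbT.
    by apply/hasPn => u; rewrite mem_filter => /andP[/andP[]].
  move=> u; rewrite mem_cat !inE mem_filter.
  have [/ZB->//|uZ'] := boolP (u \in Z).
  by have [->|] := eqVneq u y.
have [] := sort Q _ _ s three sZ.
- by rewrite /= mem_filter eqxx andbF filter_uniq.
- by move=> u; rewrite mem_filter !inE => /andP[/andP[-> _]].
- have := st; rewrite (permPl (perm_map s BQ)) perm_sym (permPl (perm_map t BQ)).
  rewrite !map_cat (_ : map t Z = map s Z) ?perm_cat2l 1?perm_sym //.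
  by apply/eq_in_map => u uZ'; rewrite sZ ?tZ.
move=> s' R [e1 e2]; apply: reach_trans R _; apply: reach_refl => u.
rewrite (perm_mem BQ) mem_cat; case: (boolP (u \in y :: Q)) => [/e1//|uQ].
by rewrite orbF => uZ'; rewrite e2 // sZ // tZ.
Qed.

(** * Gluing two boards *)

(** The contents of [B] are listed with its three holes first, and the cells of
    [B] with [Z] first; matching the two lists puts the holes on [Z]. *)
Lemma rearrange B Z s : uniq B -> uniq Z -> size Z = 3%N -> {subset Z <= B} ->
  three_holes B s ->
  exists2 t, perm_eq (map s B) (map t B) & empty_on Z t.
Proof.
move=> uB uZ zZ ZB /three_holesE s3.
pose Z0 := [seq u <- B | s u == 0%N]; pose N0 := [seq u <- B | s u != 0%N].
pose N := [seq u <- B | u \notin Z].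
have B0 : perm_eq B (Z0 ++ N0) by rewrite perm_sym perm_filterC.
have BZ : perm_eq B (Z ++ N).
  rewrite perm_sym -(permPr (permEl (perm_filterC (mem Z) B))) perm_cat2r.
  apply: uniq_perm => //; first exact: filter_uniq.
  by move=> u; rewrite mem_filter /=; case: (boolP (u \in Z)) => // /ZB.
pose v := map s (Z0 ++ N0).
pose t u := nth 0%N v (index u (Z ++ N)).
have sz : size v = size (Z ++ N) by rewrite size_map -(perm_size B0) (perm_size BZ).
exists t.
  rewrite (permPl (perm_map s B0)) perm_sym (permPl (perm_map t BZ)) -/v.
  suff -> : map t (Z ++ N) = v by [].
  apply: (@eq_from_nth _ 0%N) => [|i]; first by rewrite size_map sz.
  rewrite size_map => iN; rewrite (nth_map (0, 0)) // /t index_uniq //.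
  by rewrite -(perm_uniq BZ).
move=> u uZ'; rewrite /t index_cat uZ' /v map_cat.
have iZ : (index u Z < size (map s Z0))%N by rewrite size_map s3 -zZ index_mem.
rewrite nth_cat iZ; apply/eqP; rewrite -[_ == _]/((pred1 0%N) _).
have /allP: all (pred1 0%N) (map s Z0) by rewrite all_map filter_all.
by apply; exact: mem_nth.
Qed.

Lemma gather B Z q r s : uniq B -> solvable B -> uniq Z -> size Z = 3%N ->
  {subset Z <= B} -> q \in Z -> r \in Z -> hex_adj q r ->
  three_holes B s -> adjacent_holes B s ->
  exists2 t, reach B s t & empty_on Z t.
Proof.
move=> uB sB uZ zZ ZB qZ rZ qr s3 ds; have [t st t0] := rearrange uB uZ zZ ZB s3.
exists t => //; apply: sB => //; exists q, r; split => //; by [apply: ZB|apply: t0].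
Qed.

(** Two adjacent holes lie in [C]. If the third one is in [C] as well, [C] alone
    brings all three to their place. Otherwise it is in [B]: [C] moves its
    pair of holes to the common edge [q r], and then [B] contains three holes,
    two of them adjacent, and finishes. *)
Lemma gather_union B C U q r x s p1 p2 :
  uniq B -> uniq C -> uniq U -> {subset B <= U} -> {subset C <= U} ->
  {subset U <= [predU B & C]} ->
  solvable B -> solvable C -> edge_mobile C ->
  uniq [:: q; r; x] -> {subset [:: q; r; x] <= B} -> {subset [:: q; r; x] <= C} ->
  hex_adj q r -> three_holes U s ->
  [/\ p1 \in C, p2 \in C & hex_adj p1 p2] -> s p1 = 0%N -> s p2 = 0%N ->
  exists2 t, reach U s t & empty_on [:: q; r; x] t.
Proof.
move=> uB uC uU BU CU UBC sB sC eC uZ ZB ZC qr s3 [p1C p2C p12] s1 s2.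
have [Zq Zr] : q \in [:: q; r; x] /\ r \in [:: q; r; x] by rewrite !inE !eqxx orbT.
have [allC|] := boolP (all (mem C) [seq u <- U | s u == 0%N]).
  have C3 : three_holes C s.
    apply: (three_holes_sub uC uU CU _ _ (allP allC)) => //.
    - exact: filter_uniq.
    - exact/three_holesE.
    - by move=> u; rewrite mem_filter => /andP[/eqP].
  have [||t /(reach_patch CU) R t0] := gather uC sC uZ _ ZC Zq Zr qr C3 => //.
    by exists p1, p2.
  by eexists; [exact: R|] => u uZ'; rewrite /= ZC // t0.
rewrite -has_predC => /hasP[c]; rewrite mem_filter => /andP[/eqP sc cU] /= cC.
have cB : c \in B by move: (UBC _ cU); rewrite inE /= (negPf cC) orbF.
have e0 : empty_on [:: p1; p2] s by move=> u; rewrite !inE => /orP[] /eqP->.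
have qrC : [/\ q \in C, r \in C & hex_adj q r] by split=> //; exact: ZC.
have [t /(reach_patch CU) Rt t0] := eC _ _ _ _ (And3 p1C p2C p12) qrC _ e0.
set t' := (fun u => _) in Rt.
have t'0 : empty_on [:: q; r; c] t'.
  move=> u; rewrite /t' !inE => /or3P[] /eqP->; last by rewrite (negPf cC).
    by rewrite ZC // t0 // !inE eqxx.
  by rewrite ZC // t0 // !inE eqxx orbT.
have ucr : uniq [:: q; r; c].
  rewrite /= !inE !negb_or (hex_adj_neq qr) /= andbT.
  by apply/andP; split; apply: contraNneq cC => <-; exact: ZC.
have B3 : three_holes B t'.
  apply: (three_holes_sub uB uU BU ucr _ _ t'0) => //.
    by move=> u; rewrite !inE => /or3P[] /eqP->//; exact: ZB.
  by apply: three_holes_perm s3; exact: reach_perm.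
have [||w /(reach_patch BU) R w0] := gather uB sB uZ _ ZB Zq Zr qr B3 => //.
  by exists q, r; split; rewrite ?t'0 ?ZB // !inE eqxx ?orbT.
eexists; first exact: (reach_trans Rt R).
by move=> u uZ'; rewrite /= ZB // w0.
Qed.

(** The board is given by its characteristic predicate, because the regions
    below are compared by linear arithmetic; [B] is any enumeration of it. *)
Definition mobile (A : pred hexagon) :=
  exists B, [/\ uniq B, B =i A, edge_mobile B & solvable B].

Definition triangulated (A : pred hexagon) := forall p q,
  A p -> A q -> hex_adj p q -> exists z, [&& A z, hex_adj p z & hex_adj q z].

Lemma leads_flip B p q : leads B [:: p; q] [:: q; p].
Proof. by apply: leads_refl => u; rewrite !inE orbC. Qed.

Lemma leads_pivot B p q r : p \in B -> q \in B -> r \in B -> tri p q r ->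
  leads B [:: p; q] [:: p; r].
Proof.
move=> pB qB rB /and3P[pq pr qr].
have -> : [:: p; r] = map (exch r q) [:: p; q].
  by rewrite /= exchr exch_id ?hex_adj_neq.
apply: (@leads_slide _ r q p) => //; rewrite ?inE ?eqxx ?orbT //.
by rewrite /tri ![hex_adj r _]hex_adjC qr pr hex_adjC.
Qed.

(** Gluing boards. Four common cells suffice: the holes are parked on three of
    them, and the fourth, [y], is the centre of a star of transpositions, each
    of which takes place inside [A] or inside [A']. *)
Lemma mobile_union (A A' W : pred hexagon) q r x y :
  mobile A -> mobile A' -> (forall u, W u = A u || A' u) -> triangulated W ->
  uniq [:: q; r; x; y] -> all (predI A A') [:: q; r; x; y] -> hex_adj q r ->
  mobile W.
Proof.
move=> [B [uB BA eB sB]] [C [uC CA eC sC]] WE triW uZ /allP allZ qr.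
pose U := undup (B ++ C).
have uU : uniq U := undup_uniq _.
have UW : U =i W.
  by move=> u; rewrite mem_undup mem_cat BA CA !unfold_in WE.
have BU : {subset B <= U} by move=> u uB'; rewrite mem_undup mem_cat uB'.
have CU : {subset C <= U} by move=> u uC'; rewrite mem_undup mem_cat uC' orbT.
have UBC : {subset U <= [predU B & C]} by move=> u; rewrite mem_undup mem_cat.
have UCB : {subset U <= [predU C & B]} by move=> u /UBC; rewrite !inE orbC.
have uZ4 : uniq (rcons [:: q; r; x] y) by [].
move: uZ4; rewrite rcons_uniq => /andP[yZ {}uZ].
have ZB4 u : u \in [:: q; r; x; y] -> (u \in B) && (u \in C).
  by move=> /allZ; rewrite BA CA.
have Z34 : {subset [:: q; r; x] <= [:: q; r; x; y]}.
  by move=> u uZ'; rewrite -[[:: q; r; x; y]]/(rcons [:: q; r; x] y) mem_rcons inE uZ' orbT.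
have ZB : {subset [:: q; r; x] <= B} by move=> u /Z34/ZB4/andP[].
have ZC : {subset [:: q; r; x] <= C} by move=> u /Z34/ZB4/andP[].
have /andP[yB yC] : (y \in B) && (y \in C) by apply: ZB4; rewrite !inE eqxx !orbT.
have Zq : q \in [:: q; r; x] by rewrite !inE eqxx.
have Zr : r \in [:: q; r; x] by rewrite !inE eqxx orbT.
(* Each edge of U slides to one inside B or inside C: if p is in B and p' in C,
   the third corner z of a triangle on p p' is in B, and p z is in B, or it is
   in C, and z p' is in C. *)
pose movable p p' := exists p1 p2, [/\ leads U [:: p; p'] [:: p1; p2],
  leads U [:: p1; p2] [:: p; p'], hex_adj p1 p2 &
  (p1 \in B) && (p2 \in B) || (p1 \in C) && (p2 \in C)].
have movableC p p' : movable p p' -> movable p' p.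
  move=> [p1 [p2 [L1 L2 p12 h]]]; exists p1, p2; split=> //.
    by apply: leads_trans L1; exact: leads_flip.
  by apply: (leads_trans L2); exact: leads_flip.
have inside p p' : p \in U -> p' \in U -> hex_adj p p' -> movable p p'.
  move=> pU p'U pp'.
  have [Wp Wp'] : W p /\ W p' by move: (UW p) (UW p'); rewrite pU p'U !unfold_in => <- <-.
  have [z /and3P[Wz pz p'z]] := triW _ _ Wp Wp' pp'.
  have zU : z \in U by rewrite UW.
  have stay u v : hex_adj u v ->
      (u \in B) && (v \in B) || (u \in C) && (v \in C) -> movable u v.
    by move=> uv h; exists u, v; split=> //; exact: leads_refl.
  have via u v : u \in U -> v \in U -> tri u v z -> movable u z -> movable u v.
    move=> uIn vIn tr [p1 [p2 [L1 L2 p12 h]]]; exists p1, p2; split=> //.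
      by apply: leads_trans L1; exact: leads_pivot.
    apply: (leads_trans L2); apply: leads_pivot => //.
    by case/and3P: tr => uv uz vz; rewrite /tri uz uv hex_adjC.
  have tr : tri p p' z by rewrite /tri pp' pz p'z.
  have tr' : tri p' p z by rewrite /tri hex_adjC pp' p'z pz.
  move: (UBC _ pU) (UBC _ p'U) (UBC _ zU); rewrite !inE => /orP hp /orP hp' /orP hz.
  case: hp => hp; case: hp' => hp'.
  - by apply: stay; rewrite ?hp ?hp'.
  - case: hz => hz; first by apply: (via p p') => //; apply: stay; rewrite ?hp ?hz.
    by apply/movableC/(via p' p) => //; apply: stay; rewrite ?hp' ?hz ?orbT.
  - case: hz => hz; last by apply: (via p p') => //; apply: stay; rewrite ?hp ?hz ?orbT.
    by apply/movableC/(via p' p) => //; apply: stay; rewrite ?hp' ?hz.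
  - by apply: stay; rewrite ?hp ?hp' ?orbT.
have qrB : [/\ q \in B, r \in B & hex_adj q r] by split => //; apply: ZB.
have qrC : [/\ q \in C, r \in C & hex_adj q r] by split => //; apply: ZC.
exists U; split=> //.
  have to_qr p p' : p \in U -> p' \in U -> hex_adj p p' ->
      leads U [:: p; p'] [:: q; r] /\ leads U [:: q; r] [:: p; p'].
    move=> pU p'U pp'; have [p1 [p2 [L1 L2 p12 h]]] := inside _ _ pU p'U pp'.
    have pairs D u v : u \in D -> v \in D -> {subset [:: u; v] <= (D : seq hexagon)}.
      by move=> uD vD w; rewrite !inE => /orP[] /eqP->.
    case/orP: h => /andP[h1 h2]; split.
    - apply: leads_trans L1 _; apply: (leads_sub BU); last exact: eB.
      by apply: pairs; exact: ZB.
    - apply: leads_trans L2; apply: (leads_sub BU); last exact: eB.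
      exact: pairs.
    - apply: leads_trans L1 _; apply: (leads_sub CU); last exact: eC.
      by apply: pairs; exact: ZC.
    - apply: leads_trans L2; apply: (leads_sub CU); last exact: eC.
      exact: pairs.
  move=> p1 p1' p2 p2' [p1U p1'U e1] [p2U p2'U e2].
  by apply: (leads_trans (to_qr _ _ p1U p1'U e1).1 (to_qr _ _ p2U p2'U e2).2).
apply: (@star_solvable _ [:: q; r; x] y) => //.
- by move=> u /ZB/BU.
- exact: BU.
- move=> s s3 [p [p' [pU p'U pp' sp sp']]].
  have [p1 [p2 [L1 _ p12 h]]] := inside _ _ pU p'U pp'.
  have [|t Rt t0] := L1 s; first by move=> u; rewrite !inE => /orP[]/eqP->.
  have [t1 t2] : t p1 = 0%N /\ t p2 = 0%N by rewrite !t0 // !inE eqxx ?orbT.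
  have t3 : three_holes U t by apply: three_holes_perm s3; exact: reach_perm.
  suff [w Rw w0] : exists2 w, reach U t w & empty_on [:: q; r; x] w.
    by exists w => //; exact: reach_trans Rw.
  case/orP: h => /andP[h1 h2].
    exact: (gather_union uC uB uU CU BU UCB sC sB eB uZ ZC ZB qr t3 (And3 h1 h2 p12)).
  exact: (gather_union uB uC uU BU CU UBC sB sC eC uZ ZB ZC qr t3 (And3 h1 h2 p12)).
- move=> s p s3 s0 pU pZ _.
  have direct D : uniq D -> {subset D <= U} -> {subset [:: q; r; x] <= D} ->
      y \in D -> p \in D -> solvable D -> reach U s (s \o exch y p).
    move=> uD DU ZD yD pD sD.
    have fixZ u : u \in [:: q; r; x] -> exch y p u = u.
      move=> uZ'; apply: exch_id.
        by apply: contraNneq yZ => <-.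
      by apply: contraNneq pZ => <-.
    apply: (reach_sub DU).
      apply: sD.
      - exact: (three_holes_sub uD uU DU uZ).
      - by rewrite perm_sym perm_map_exch.
      - by exists q, r; split; rewrite ?s0 ?ZD.
      - by exists q, r; split; rewrite /= ?fixZ ?s0 ?ZD.
    move=> u uD' /=; rewrite exch_id //.
      by apply: contraNneq uD' => ->.
    by apply: contraNneq uD' => ->.
  case/orP: (UBC _ pU) => pD; [exact: (direct B)|exact: (direct C)].
Qed.

(** * Symmetries of the lattice *)

Lemma reach_map B (f g : hexagon -> hexagon) s t : cancel f g -> cancel g f ->
  {mono f : p q / hex_adj p q} -> reach B s t ->
  reach (map f B) (s \o g) (t \o g).
Proof.
move=> fK gK fadj; elim=> {s t} [s t st|s t p q r [pB qB rB] tr sq sr _ IH].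
  by apply: reach_refl => _ /mapP[u uB ->] /=; rewrite fK st.
apply: (@reach_slide _ _ _ (f p) (f q) (f r)); rewrite /= ?fK //.
- by split; exact: map_f.
- by rewrite /tri !fadj.
apply: reach_eql IH => u _ /=; congr (s _).
rewrite /exch -[u == f p](can_eq gK) -[u == f q](can_eq gK) !fK.
by do 2!case: ifP => // _; rewrite fK.
Qed.

Lemma mobile_map (A A' : pred hexagon) (f g : hexagon -> hexagon) :
  cancel f g -> cancel g f -> {mono f : p q / hex_adj p q} ->
  (forall p, A' p = A (g p)) -> mobile A -> mobile A'.
Proof.
move=> fK gK fadj A'E [B [uB BA eB sB]]; have finj := can_inj fK.
have gadj : {mono g : p q / hex_adj p q} by move=> p q; rewrite -fadj !gK.
have memB p : (p \in map f B) = (g p \in B) by rewrite -{1}[p]gK mem_map.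
have mapE (s : state) : map s (map f B) = map (s \o f) B by rewrite -map_comp.
have back s t : reach B (s \o f) (t \o f) -> reach (map f B) s t.
  move=> /(reach_map fK gK fadj) R; apply: (@reach_eql _ _ (s \o f \o g)).
    by move=> u _ /=; rewrite gK.
  by apply: reach_trans R _; apply: reach_refl => u _ /=; rewrite gK.
exists (map f B); split.
- by rewrite map_inj_uniq.
- by move=> p; rewrite memB BA !unfold_in A'E.
- move=> p q p' q'; rewrite !memB -gadj -[hex_adj p' q']gadj => e e' s s0.
  have [|t Rt t0] := eB _ _ _ _ e e' (s \o f).
    by move=> u; rewrite !inE => /orP[]/eqP-> /=; rewrite gK s0 // !inE eqxx ?orbT.
  exists (t \o g); last first.
    by move=> u; rewrite !inE => /orP[]/eqP-> /=; rewrite t0 // !inE eqxx ?orbT.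
  apply: back; apply: reach_trans Rt _.
  by apply: reach_refl => u _ /=; rewrite fK.
have adjf s : adjacent_holes (map f B) s -> adjacent_holes B (s \o f).
  move=> [p [q [+ + + sp sq]]]; rewrite !memB -gadj => pB qB pq.
  by exists (g p), (g q); rewrite /= !gK.
move=> s t; rewrite /three_holes !mapE => s3 st ds dt.
by apply/back/sB => //; exact: adjf.
Qed.

Lemma mobile_eq (A A' : pred hexagon) : A =1 A' -> mobile A -> mobile A'.
Proof. by move=> AA' [B [uB BA eB sB]]; exists B; split=> // u; rewrite BA !unfold_in AA'. Qed.

Definition shift (d : hexagon) (A : pred hexagon) : pred hexagon :=
  fun p => A (p.1 - d.1, p.2 - d.2).

(** The image of [A] under the rotation by a sixth of a turn, which in these
    coordinates sends (i, j) to (i - j, i). *)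
Definition turn (A : pred hexagon) : pred hexagon := fun p => A (p.2, p.2 - p.1).

Lemma mobile_shift d A : mobile A -> mobile (shift d A).
Proof.
apply: (@mobile_map _ _ (fun p => (p.1 + d.1, p.2 + d.2))
                        (fun p => (p.1 - d.1, p.2 - d.2))) => //.
- by move=> [i j]; rewrite /= !addrK.
- by move=> [i j]; rewrite /= !subrK.
- by move=> [i j] [k l]; rewrite !hex_adjE /=; lia.
Qed.

Lemma mobile_turn A : mobile A -> mobile (turn A).
Proof.
apply: (@mobile_map _ _ (fun p => (p.1 - p.2, p.1)) (fun p => (p.2, p.2 - p.1))) => //.
- by move=> [i j] /=; congr pair; lia.
- by move=> [i j] /=; congr pair; lia.
- by move=> [i j] [k l]; rewrite !hex_adjE /=; lia.
Qed.

(** * The eared flower *)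

(** A word is a list of slides [(p, q)]. Its first slide is applied first to the
    state, hence outermost in the composition that sends each cell to the one
    where its final content came from. *)
Definition act (w : seq (hexagon * hexagon)) u : hexagon :=
  foldr (fun m => exch m.1 m.2) u w.

Fixpoint legal B Z (w : seq (hexagon * hexagon)) : bool :=
  if w is (p, q) :: w' then
    [&& p \in B, q \in B, q \in Z, has (fun r => (r \in B) && tri p q r) Z &
        legal B (map (exch p q) Z) w']
  else true.

Lemma legal_reach B Z w s : legal B Z w -> empty_on Z s -> reach B s (s \o act w).
Proof.
elim: w Z s => [|[p q] w IH] Z s /=; first by move=> _ _; exact: reach_refl.
case/and5P=> pB qB qZ /hasP[r rZ /andP[rB tr]] lw s0.
apply: (@reach_slide _ _ _ p q r) => //; try exact: s0.
apply: reach_trans (IH _ _ lw _) _; last exact: reach_refl.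
by move=> _ /mapP[u uZ ->] /=; rewrite exchK s0.
Qed.

Fixpoint subseqs B : seq (seq hexagon) :=
  if B is u :: B' then map (cons u) (subseqs B') ++ subseqs B' else [:: [::]].

Lemma filter_subseqs (a : pred hexagon) B : [seq u <- B | a u] \in subseqs B.
Proof.
elim: B => //= u B IH; rewrite mem_cat; case: (a u); last by rewrite IH orbT.
by rewrite map_f.
Qed.

Lemma subseqs_sub B Z : Z \in subseqs B -> all (mem B) Z.
Proof.
elim: B Z => [|u B IH] Z /=; first by rewrite inE => /eqP->.
rewrite mem_cat => /orP[/mapP[Z' /IH ZB ->]|/IH ZB].
  by rewrite /= mem_head /=; apply: sub_all ZB => v /= vB; rewrite inE vB orbT.
by apply: sub_all ZB => v /= vB; rewrite inE vB orbT.
Qed.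

(** Hole sets are written in the order of [B], so that equal sets are equal
    lists. *)
Definition slides B Z : seq (seq hexagon) :=
  [seq [seq u <- B | exch m.1 m.2 u \in Z] |
     m <- [seq (p, q) | p <- B, q <- Z] &
     (m.2 \in B) && has (fun r => (r \in B) && tri m.1 m.2 r) Z].

(** One round of a breadth-first search among the candidate hole sets [c]. *)
Definition grow B (c L : seq (seq hexagon)) : seq (seq hexagon) :=
  L ++ [seq Z <- c | (Z \notin L) && has (fun Z' => Z' \in L) (slides B Z)].

Lemma slides_leads B Z Z' : {subset Z <= B} -> Z' \in slides B Z ->
  leads B Z Z' /\ leads B Z' Z.
Proof.
move=> ZB /mapP[[p q]]; rewrite mem_filter => /andP[/andP[/= qB /hasP[r rZ /andP[rB tr]]]].
move=> /allpairsP[[p' q']] /= [pB qZ [Ep Eq]]; subst p' q' => ->.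
have /and3P[pq pr qr] := tr.
split=> s s0.
  exists (s \o exch p q).
    by apply: (@reach_slide _ _ _ p q r); rewrite ?s0 //; exact: reach_refl.
  by move=> u; rewrite mem_filter /= => /andP[uZ _]; exact: s0.
exists (s \o exch q p).
  apply: (@reach_slide _ _ _ q p r); first by [].
  - by rewrite /tri hex_adjC pq qr pr.
  - by apply: s0; rewrite mem_filter exchl qZ.
  - by apply: s0; rewrite mem_filter exch_id ?rZ // eq_sym hex_adj_neq.
  - exact: reach_refl.
move=> u uZ /=; apply: s0; rewrite exchC mem_filter exchK uZ exch_mem //.
exact: ZB.
Qed.

Lemma growP B Z0 c n Z : all (all (mem B)) c ->
  Z \in iter n (grow B c) [:: Z0] -> leads B Z Z0 /\ leads B Z0 Z.
Proof.
move=> /allP cB; elim: n Z => [|n IH] Z.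
  by rewrite inE => /eqP->; split; exact: leads_refl.
rewrite /= mem_cat => /orP[/IH//|]; rewrite mem_filter.
move=> /andP[/andP[_ /hasP[Z' /slides_leads L /IH[L1 L2]]] /cB/allP ZB].
have [L3 L4] := L ZB.
by split; [exact: leads_trans L1|exact: leads_trans L4].
Qed.

Definition linked Z := has (fun p => has (hex_adj p) Z) Z.

Definition ring6 : seq hexagon := [:: (1, 0); (1, 1); (0, 1); (-1, 0); (-1, -1); (0, -1)].

(** Words refer to the cells of [eared] by their rank: 0 is the centre, 1 to 6
    the ring in cyclic order, 7 the ear, which touches 1 and 2. *)
Definition eared : seq hexagon := (0, 0) :: rcons ring6 (2, 1).

Definition steps (w : seq (nat * nat)) : seq (hexagon * hexagon) :=
  [seq (nth (0, 0) eared m.1, nth (0, 0) eared m.2) | m <- w].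

(** With holes at 0, 1, 2, this exchanges the tiles of 7 and 3. The ring tiles
    advance by one cell; the first of them, which came from 3, steps aside into
    the centre while the ear's tile drops into 2, and then passes to 1. The
    ring moves back, taking the ear's tile to 3, and the tile waiting at 1
    enters the ear. *)
Definition swap_near : seq (nat * nat) :=
  [:: (3, 2); (4, 3); (5, 4); (6, 5); (2, 0); (7, 2); (0, 1); (5, 6); (4, 5);
      (3, 4); (2, 3); (1, 7)]%N.

(** The exchange of 7 and 4. The ring tiles form a queue whose head, the tile of
    3, is carried through the centre to the rear; the exchange of [swap_near]
    is then made with the new head, which came from 4, and the last five slides
    bring the tile of 3 back to the front. *)
Definition swap_far : seq (nat * nat) :=
  [:: (3, 0); (0, 1); (4, 0); (0, 2); (5, 0); (0, 3); (6, 0); (0, 4); (1, 0);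
      (0, 5); (2, 0); (7, 2); (0, 1); (5, 6); (4, 5); (3, 4); (2, 3); (1, 7);
      (6, 0); (0, 2); (5, 6); (4, 5); (3, 4); (2, 3)]%N.

(** The reflection of the eared flower that fixes the ear. *)
Definition mirror (w : seq (nat * nat)) : seq (nat * nat) :=
  let f := nth 0%N [:: 0; 2; 1; 6; 5; 4; 3; 7]%N in [seq (f m.1, f m.2) | m <- w].

Definition swap_word p := steps (nth [::]
  [:: swap_near; swap_far; mirror swap_far; mirror swap_near] (index p (drop 2 ring6))).

(** The finite verification. Each word must induce the announced transposition
    up to a permutation of the holes. Every hole set of size three, or two, that
    contains an edge is found within four, respectively three, rounds of search
    from the base set. *)
Lemma eared_base :
  let Z := take 3 eared in let E := eared in
  [/\ all (fun p => legal E Z (swap_word p) &&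
        all (fun u => (act (swap_word p) u == exch (2, 1) p u)
          || (u \in Z) && (act (swap_word p) u \in Z)) E) (drop 2 ring6),
      let c := [seq Z' <- subseqs E | (size Z' == 3%N) && linked Z'] in
      all (mem (iter 4 (grow E c) [:: Z])) c
    & let c' := [seq Z' <- subseqs E | (size Z' == 2%N) && linked Z'] in
      all (mem (iter 3 (grow E c') [:: [:: (0, 0); (1, 0)]])) c'].
Proof. by split; vm_compute. Qed.

Lemma edge_mobile_eared : edge_mobile eared.
Proof.
have [_ _ /allP e2] := eared_base.
have to_base p q : [/\ p \in eared, q \in eared & hex_adj p q] ->
    leads eared [:: p; q] [:: (0, 0); (1, 0)] /\
    leads eared [:: (0, 0); (1, 0)] [:: p; q].
  move=> [pE qE pq]; pose Z := [seq u <- eared | u \in [:: p; q]].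
  have ZE : Z =i [:: p; q].
    move=> u; rewrite mem_filter; apply: andb_idr.
    by rewrite in_cons mem_seq1 => /orP[] /eqP->.
  have szZ : size Z = 2%N.
    have uZ : uniq Z by rewrite filter_uniq.
    have upq : uniq [:: p; q] by rewrite /= inE hex_adj_neq.
    by rewrite (perm_size (uniq_perm uZ upq ZE)).
  have lZ : linked Z.
    by apply/hasP; exists p; [rewrite ZE mem_head|apply/hasP; exists q => //; rewrite ZE !inE eqxx orbT].
  have [||L1 L2] := @growP eared _ _ _ Z _ (e2 Z _).
  - apply/allP => Z'; rewrite mem_filter => /andP[_]; exact: subseqs_sub.
  - by rewrite mem_filter szZ lZ filter_subseqs.
  split; [apply: leads_trans L1|apply: (leads_trans L2)];
    by apply: leads_refl => u; rewrite ZE.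
move=> p q p' q' /to_base[L _] /to_base[_ L']; exact: leads_trans L'.
Qed.

Lemma solvable_eared : solvable eared.
Proof.
have [/allP star /allP norm _] := eared_base.
apply: (@star_solvable _ (take 3 eared) (2, 1)) => //.
- by move=> u /mem_take.
- move=> s /three_holesE s3 [p [q [pE qE pq sp sq]]].
  pose Z := [seq u <- eared | s u == 0%N].
  have ZE u : u \in eared -> s u = 0%N -> u \in Z.
    by rewrite mem_filter => -> ->.
  have [||L _] := @growP eared _ _ _ Z _ (norm Z _).
  - apply/allP => Z'; rewrite mem_filter => /andP[_]; exact: subseqs_sub.
  - rewrite mem_filter s3 filter_subseqs andbT /=.
    by apply/hasP; exists p; [exact: ZE|apply/hasP; exists q => //; exact: ZE].
  by apply: L => u; rewrite mem_filter => /andP[/eqP].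
- move=> s p _ s0 pE pZ py.
  have /star/andP[lw /allP aw] : p \in drop 2 ring6.
    move: pE; rewrite -[eared]/(take 3 eared ++ rcons (drop 2 ring6) (2, 1)).
    by rewrite mem_cat (negPf pZ) mem_rcons in_cons (negPf py).
  apply: reach_trans (legal_reach lw s0) _; apply: reach_refl => u /aw /=.
  case/orP=> [/eqP->//|/andP[uZ auZ]]; rewrite exch_id ?s0 //.
    by apply: contraTneq uZ => ->.
  by apply: contraTneq uZ => ->.
Qed.

Lemma mobile_eared : mobile (mem eared).
Proof. by exists eared; split=> //; [exact: edge_mobile_eared|exact: solvable_eared]. Qed.

(** * Triangles and flowers *)

(** Triangles, flowers and every intermediate union in the two inductions below
    are hexagons, possibly degenerate, with sides along the three lattice
    directions; so comparing boards is linear arithmetic. *)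
Definition region (a1 b1 a2 b2 a3 b3 : int) : pred hexagon := fun p =>
  [&& a1 <= p.1, p.1 <= b1, a2 <= p.2, p.2 <= b2, a3 <= p.1 - p.2 & p.1 - p.2 <= b3].

Lemma triangulatedI (A : pred hexagon) :
  (forall i j, [/\ A (i, j) -> A (i + 1, j) -> A (i + 1, j + 1) || A (i, j - 1),
                A (i, j) -> A (i, j + 1) -> A (i + 1, j + 1) || A (i - 1, j) &
                A (i, j) -> A (i + 1, j + 1) -> A (i + 1, j) || A (i, j + 1)]) ->
  triangulated A.
Proof.
move=> H.
have half p q : A p -> A q -> (q \in [:: (p.1 + 1, p.2); (p.1, p.2 + 1); (p.1 + 1, p.2 + 1)]) ->
    exists z, [&& A z, hex_adj p z & hex_adj q z].
  case: p => i j Ap Aq /=; have [h1 h2 h3] := H i j.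
  rewrite !inE => /or3P[] /eqP e; subst q.
  - case/orP: (h1 Ap Aq) => Az; [exists (i + 1, j + 1)|exists (i, j - 1)];
      by rewrite Az !hex_adjE /=; lia.
  - case/orP: (h2 Ap Aq) => Az; [exists (i + 1, j + 1)|exists (i - 1, j)];
      by rewrite Az !hex_adjE /=; lia.
  - case/orP: (h3 Ap Aq) => Az; [exists (i + 1, j)|exists (i, j + 1)];
      by rewrite Az !hex_adjE /=; lia.
move=> p q Ap Aq pq.
have [h|h] : q \in [:: (p.1 + 1, p.2); (p.1, p.2 + 1); (p.1 + 1, p.2 + 1)] \/
             p \in [:: (q.1 + 1, q.2); (q.1, q.2 + 1); (q.1 + 1, q.2 + 1)].
- by move: pq; case: p q {Ap Aq} => [i j] [k l]; rewrite hex_adjE !inE !xpair_eqE /=; lia.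
- exact: half.
- by have [z /and3P[Az qz pz]] := half _ _ Aq Ap h; exists z; rewrite Az pz qz.
Qed.

Lemma region_triangulated a1 b1 a2 b2 a3 b3 : a1 < b1 -> a2 < b2 -> a3 < b3 ->
  triangulated (region a1 b1 a2 b2 a3 b3).
Proof.
by move=> h1 h2 h3; apply: triangulatedI => i j; rewrite /region /=; split; lia.
Qed.

Lemma eared_region p :
  (p \in eared) = region (-1) 1 (-1) 1 (-1) 1 p || (p == (2, 1)).
Proof. by case: p => i j; rewrite /region !inE !xpair_eqE /=; lia. Qed.

(** The triangle of side 4 is a flower with an ear at each of its corners. *)
Lemma mobile_triangle4 : mobile (region 0 3 0 3 0 3).
Proof.
pose F := region (-1) 1 (-1) 1 (-1) 1.
have E1 : mobile (fun p => F p || (p == (1, 2))).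
  apply: mobile_eq (mobile_turn mobile_eared) => -[i j].
  by rewrite /turn /F /region [mem _ _]eared_region /region !xpair_eqE /=; lia.
have E3 : mobile (fun p => F p || (p == (-2, -1))).
  apply: mobile_eq (mobile_turn (mobile_turn E1)) => -[i j].
  by rewrite /turn /F /region !xpair_eqE /=; lia.
have E5 : mobile (fun p => F p || (p == (1, -1))).
  apply: mobile_eq (mobile_turn (mobile_turn E3)) => -[i j].
  by rewrite /turn /F /region !xpair_eqE /=; lia.
have E13 : mobile (fun p => [|| F p, p == (1, 2) | p == (-2, -1)]).
  apply: (@mobile_union _ _ _ (0, 0) (1, 0) (1, 1) (0, 1) E1 E3) => //.
    by move=> p; case: (F p).
  by apply: triangulatedI => i j; rewrite /F /region !xpair_eqE /=; split; lia.
have T : mobile (region (-2) 1 (-1) 2 (-1) 2).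
  apply: (@mobile_union _ _ _ (0, 0) (1, 0) (1, 1) (0, 1) E13 E5) => //.
    by move=> [i j]; rewrite /F /region !xpair_eqE /=; lia.
  exact: region_triangulated.
apply: mobile_eq (mobile_shift (2, 1) T) => -[i j].
by rewrite /shift /region /=; lia.
Qed.

(** The triangle of side [m + 1] is the union of three translates of that of
    side [m]. *)
Lemma mobile_triangle (n : nat) : mobile (region 0 n.+3%:Z 0 n.+3%:Z 0 n.+3%:Z).
Proof.
elim: n => [|n IH]; first exact: mobile_triangle4.
set N := n.+3%:Z in IH.
have W : mobile (region 0 (N + 1) 0 N 0 (N + 1)).
  apply: (@mobile_union _ _ _ (1, 0) (2, 0) (2, 1) (3, 0) IH (mobile_shift (1, 0) IH)) => //.
  - by move=> [i j]; rewrite /shift /region /N /=; lia.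
  - by apply: region_triangulated; rewrite /N; lia.
apply: (@mobile_union _ _ _ (1, 1) (2, 1) (2, 2) (3, 1) W (mobile_shift (1, 1) IH)) => //.
- by move=> [i j]; rewrite /shift /region /N /=; lia.
- by apply: region_triangulated; lia.
Qed.

(** Two overlapping flowers, each of which carries an ear inside the other. *)
Lemma mobile_double_flower : mobile (region (-1) 2 (-1) 1 (-1) 2).
Proof.
have E' := mobile_shift (1, 0) (mobile_turn (mobile_turn mobile_eared)).
apply: (@mobile_union _ _ _ (0, 0) (1, 0) (1, 1) (0, -1) mobile_eared E') => //.
- move=> [i j]; rewrite /shift /turn ![mem _ _]eared_region /region !xpair_eqE /=; lia.
- exact: region_triangulated.
Qed.

(** A flower with one more layer is the Minkowski sum of the flower with the
    segments from 0 to (1, 0), to (0, 1) and to (-1, -1): their own sum is the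
    flower with two layers. Each segment amounts to a union with one
    translate. The induction starts from the double flower, which is already
    the sum of the flower with two layers and the first segment. *)
Lemma mobile_flower (n : nat) :
  mobile (region (- n.+2%:Z) n.+2%:Z (- n.+2%:Z) n.+2%:Z (- n.+2%:Z) n.+2%:Z).
Proof.
have widen (N : int) : 1 <= N -> mobile (region (- N) (N + 1) (- N) N (- N) (N + 1)) ->
    mobile (region (- (N + 1)) (N + 1) (- (N + 1)) (N + 1) (- (N + 1)) (N + 1)).
  move=> N1 W1.
  have W2 : mobile (region (- N) (N + 1) (- N) (N + 1) (- (N + 1)) (N + 1)).
    apply: (@mobile_union _ _ _ (0, 0) (1, 0) (1, 1) (0, 1) W1 (mobile_shift (0, 1) W1)) => //.
    - by move=> [i j]; rewrite /shift /region /=; lia.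
    - by apply: region_triangulated; lia.
    - by rewrite /= /shift /region /=; lia.
  apply: (@mobile_union _ _ _ (0, 0) (1, 0) (1, 1) (0, 1) W2 (mobile_shift (-1, -1) W2)) => //.
  - by move=> [i j]; rewrite /shift /region /=; lia.
  - by apply: region_triangulated; lia.
  - by rewrite /= /shift /region /=; lia.
elim: n => [|n IH]; first exact: (widen 1 _ mobile_double_flower).
set N := n.+2%:Z in IH.
rewrite (_ : n.+3%:Z = N + 1); last by rewrite /N; lia.
apply: widen; first by rewrite /N; lia.
apply: (@mobile_union _ _ _ (0, 0) (1, 0) (1, 1) (0, -1) IH (mobile_shift (1, 0) IH)) => //.
- by move=> [i j]; rewrite /shift /region /N /=; lia.
- by apply: region_triangulated; rewrite /N; lia.
Qed.

(** * From states to configurations *)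

Lemma pos_inj (D : board) h (c : config D h) : injective (pos c).
Proof. by apply/injectiveP; exact: (valP c). Qed.

Definition tile_cells (D : board) h (c : config D h) : seq hexagon :=
  [seq val (pos c a) | a <- enum 'I_(#|` D| - h)].

Lemma tile_cells_uniq (D : board) h (c : config D h) : uniq (tile_cells c).
Proof. by rewrite map_inj_uniq ?enum_uniq // => a b /val_inj/pos_inj. Qed.

Lemma tile_cells_sub (D : board) h (c : config D h) : {subset tile_cells c <= D}.
Proof. by move=> _ /mapP[a _ ->]; exact: valP. Qed.

Lemma mem_tile_cells (D : board) h (c : config D h) a : val (pos c a) \in tile_cells c.
Proof. by apply/mapP; exists a; rewrite ?mem_enum. Qed.

Lemma is_holeE (D : board) h (c : config D h) (q : D) :
  is_hole c q = (val q \notin tile_cells c).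
Proof.
apply/forallP/idP => [hq|/mapP hq a].
  by apply/mapP => -[a _ /val_inj qa]; move: (hq a); rewrite -qa eqxx.
by apply/eqP => qa; apply: hq; exists a; rewrite ?mem_enum ?qa.
Qed.

(** The correspondence between configurations and states: tile [a] is written
    [a + 2], while a hole reads 0, as one of the three genuine holes, or 1, as a
    hole that is treated as a tile. *)
Definition reads (D : board) h (c : config D h) s :=
  (forall a, s (val (pos c a)) = a.+2) /\
  (forall u, u \in D -> u \notin tile_cells c -> (s u <= 1)%N).

Lemma reads_hole (D : board) h (c : config D h) s u :
  reads c s -> s u = 0%N -> u \notin tile_cells c.
Proof. by move=> [sc _] su; apply/mapP => -[a _ e]; move: su; rewrite e sc. Qed.

Lemma reads_inj (D : board) h (c d : config D h) s : reads c s -> reads d s -> c = d.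
Proof.
move=> [sc hc] [sd hd]; apply/val_inj/ffunP => a; apply/val_inj.
rewrite -[val c a]/(pos c a) -[val d a]/(pos d a).
have [/mapP[b _ e]|ad] := boolP (val (pos c a) \in tile_cells d).
  have : s (val (pos d b)) = a.+2 by rewrite -e sc.
  by rewrite sd => -[/val_inj ba]; rewrite e ba.
by have := hd _ (valP (pos c a)) ad; rewrite sc.
Qed.

(** A slide of a state moves a tile or moves a hole that is treated as a tile;
    in the second case the configuration does not change. *)
Lemma reach_connect (D : board) h B s t (c d : config D h) : B =i D ->
  reach B s t -> reads c s -> reads d t -> connect (@puz D h) c d.
Proof.
move=> BD R; elim: R c => {s t} [s t st|s t p q r [pB qB rB] tr sq sr _ IH] c rc rd.
  have -> : c = d; last exact: connect0.
  apply: reads_inj rc _; case: rd => sd hd; split=> [a|u uD].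
    by rewrite st ?sd // BD; exact: valP.
  by rewrite st ?BD //; exact: hd.
have /and3P[pq pr qr] := tr.
have [qD rD] : q \in D /\ r \in D by rewrite -!BD.
have qh := reads_hole rc sq; have rh := reads_hole rc sr.
have [/mapP[a _ pa]|ph] := boolP (p \in tile_cells c); last first.
  apply: IH rd; case: rc => sc hc; split=> [b|u uD uc] /=.
    rewrite exch_id ?sc //.
      by apply: contraNneq ph => <-; exact: mem_tile_cells.
    by apply: contraNneq qh => <-; exact: mem_tile_cells.
  rewrite /exch; case: eqP => _; first by rewrite sq.
  by case: eqP => _; apply: hc => //; rewrite -BD.
pose f : {ffun 'I_(#|` D| - h) -> D} := [ffun b => if b == a then [` qD]%fset else pos c b].
have fi : injectiveb f.
  apply/injectiveP => b1 b2; rewrite !ffunE.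
  have qn b : [` qD]%fset <> pos c b.
    move=> /(congr1 val) /= e; move: qh; rewrite e mem_tile_cells //.
  case: eqP => [->|_]; case: eqP => [->|_] // e; [by case: (qn b2)|by case: (qn b1)|exact: pos_inj e].
pose c' : config D h := exist _ f fi.
have posa b : pos c' b = if b == a then [` qD]%fset else pos c b by rewrite /pos /= ffunE.
apply: (@connect_trans _ _ c').
  apply/connect1/orP; left; apply/existsP; exists a; apply/existsP; exists [` qD]%fset.
  apply/and3P; split; last 1 first.
  - by apply/forallP => b; apply/implyP => /negPf ba; rewrite posa ba.
  - apply/and3P; split; [by rewrite is_holeE|by rewrite -pa|].
    apply/existsP; exists [` rD]%fset; rewrite is_holeE /= rh -pa hex_adjC pr hex_adjC qr !andbT.
    by apply/eqP => /(congr1 val) /= e; move: (hex_adj_neq qr); rewrite e eqxx.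
  - by rewrite posa eqxx.
apply: IH rd; case: rc => sc hc; split=> [b|u uD uc'] /=.
  rewrite posa; case: (eqVneq b a) => [->|ba] /=; first by rewrite exchr pa sc.
  rewrite exch_id ?sc //.
    by rewrite pa; apply: contraNneq ba => /val_inj/pos_inj->.
  by apply: contraNneq qh => <-; exact: mem_tile_cells.
have uq : u != q.
  by apply: contraNneq uc' => ->; have := mem_tile_cells c' a; rewrite posa eqxx.
have [->|up] := eqVneq u p; first by rewrite exchl sq.
rewrite exch_id //; apply: hc => //; apply: contraNN uc' => /mapP[b _ ub].
have := mem_tile_cells c' b; rewrite posa; case: eqP => [ba|_]; last by rewrite -ub.
by move: up; rewrite ub ba pa eqxx.
Qed.

(** [Z] lists the three genuine holes; any other hole is treated as a tile with
    label 1. *)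
Definition state_of (D : board) h (c : config D h) Z : state := fun u =>
  if u \in Z then 0%N
  else if [pick a | val (pos c a) == u] is Some a then a.+2 else 1%N.

Lemma state_of_tile (D : board) h (c : config D h) Z a :
  {in Z, forall u, u \notin tile_cells c} -> state_of c Z (val (pos c a)) = a.+2.
Proof.
move=> Zc; rewrite /state_of; case: ifP => [/Zc|_]; first by rewrite mem_tile_cells.
by case: pickP => [b /eqP/val_inj/pos_inj->|/(_ a)] //; rewrite eqxx.
Qed.

Lemma state_of_hole (D : board) h (c : config D h) Z u :
  u \notin tile_cells c -> u \notin Z -> state_of c Z u = 1%N.
Proof.
move=> uc /negPf uZ; rewrite /state_of uZ; case: pickP => // a /eqP ua.
by move: uc; rewrite -ua mem_tile_cells.
Qed.

Lemma const_map (T : eqType) (S : eqType) (f : T -> S) (a : S) (l : seq T) :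
  {in l, forall b, f b = a} -> map f l = nseq (size l) a.
Proof.
move=> fl; rewrite -(size_map f); apply/all_pred1P; rewrite all_map.
by apply/allP => b /fl /= ->.
Qed.

(** The right-hand side depends neither on [c] nor on [Z], so any two
    configurations yield states with the same contents. *)
Lemma state_of_perm (D : board) h (c : config D h) B Z : (h < #|` D|)%N ->
  uniq B -> B =i D -> uniq Z -> size Z = 3%N -> {subset Z <= B} ->
  {in Z, forall u, u \notin tile_cells c} ->
  perm_eq (map (state_of c Z) B)
    (nseq 3 0%N ++ map (fun a : 'I_(#|` D| - h) => a.+2) (enum 'I_(#|` D| - h))
     ++ nseq (h - 3) 1%N).
Proof.
move=> hD uB BD uZ zZ ZB Zc.
pose R := [seq u <- B | (u \notin tile_cells c) && (u \notin Z)].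
have BP : perm_eq B (Z ++ tile_cells c ++ R).
  apply: uniq_perm => //.
    rewrite cat_uniq uZ cat_uniq tile_cells_uniq filter_uniq // andbT /=.
    apply/andP; split; apply/hasPn => u; rewrite ?mem_cat ?mem_filter.
      by case/orP=> [uc|/andP[/andP[_ ->]//]]; apply: contraTN uc => /Zc.
    by case/andP => /andP[].
  move=> u; rewrite !mem_cat mem_filter.
  have [/ZB->//|_] := boolP (u \in Z).
  have [/tile_cells_sub|_] /= := boolP (u \in tile_cells c); first by rewrite BD.
  by [].
have szR : size R = (h - 3)%N.
  have szB : size B = #|` D| by apply: perm_size; apply: uniq_perm => //; exact: fset_uniq.
  have := perm_size BP; rewrite !size_cat zZ size_map size_enum_ord szB.
  lia.
rewrite (permPl (perm_map _ BP)) !map_cat.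
have -> : map (state_of c Z) Z = nseq 3 0%N.
  by rewrite -zZ (@const_map _ _ _ 0%N) // => u uZ'; rewrite /state_of uZ'.
have -> : map (state_of c Z) (tile_cells c) =
    map (fun a : 'I_(#|` D| - h) => a.+2) (enum 'I_(#|` D| - h)).
  by rewrite -map_comp; apply: eq_map => a /=; rewrite state_of_tile.
have -> // : map (state_of c Z) R = nseq (h - 3) 1%N.
rewrite -szR (@const_map _ _ _ 1%N) // => u; rewrite mem_filter.
by case/andP => /andP[uc uZ'] _; exact: state_of_hole.
Qed.

Lemma state_of_reads (D : board) h (c : config D h) Z :
  {in Z, forall u, u \notin tile_cells c} -> reads c (state_of c Z).
Proof.
move=> Zc; split=> [a|u _ uc]; first exact: state_of_tile.
have [uZ|uZ] := boolP (u \in Z); first by rewrite /state_of uZ.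
by rewrite state_of_hole.
Qed.

(** The two holes of a possible slide are adjacent, and as there are at least
    three holes one more can be picked. *)
Lemma three_holes_of (D : board) h (c : config D h) : (3 <= h)%N -> (h < #|` D|)%N ->
  non_isolated c -> exists q r x, [/\ uniq [:: q; r; x], {subset [:: q; r; x] <= D},
    {in [:: q; r; x], forall u, u \notin tile_cells c} & hex_adj q r].
Proof.
move=> h3 hD /existsP[a /existsP[q /and3P[hq _ /existsP[r /and4P[_ hr _ rq]]]]].
rewrite !is_holeE in hq hr; rewrite hex_adjC in rq.
have [|allx] := boolP (has [predC tile_cells c ++ [:: val q; val r]] D).
  case/hasP=> x xD; rewrite /= mem_cat negb_or !inE negb_or => /and3P[xc xq xr].
  exists (val q), (val r), x; split=> //.
  - by rewrite /= !inE !negb_or (hex_adj_neq rq) eq_sym xq eq_sym xr.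
  - by move=> u; rewrite !inE => /or3P[]/eqP->//; exact: valP.
  - by move=> u; rewrite !inE => /or3P[]/eqP->.
have : (#|` D| <= size (tile_cells c ++ [:: val q; val r]))%N.
  apply: uniq_leq_size => [|u uD]; first exact: fset_uniq.
  by move/hasPn/(_ u uD): allx; rewrite /= negbK.
rewrite size_cat size_map size_enum_ord /= => le; exfalso; move: h3 hD le; set n := #|` D|; lia.
Qed.

(** One tile goes to [p], and the others avoid [q] and [r]; there is room for
    them because at least three cells stay empty. *)
Lemma non_isolated_exists (D : board) h p q r : (3 <= h)%N -> (h < #|` D|)%N ->
  p \in D -> q \in D -> r \in D -> tri p q r -> exists c : config D h, non_isolated c.
Proof.
move=> h3 hD pD qD rD /and3P[pq pr qr].
pose L : seq D := [` pD]%fset ::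
  [seq u <- enum {: D} | val u \notin [:: p; q; r]].
have uL : uniq L.
  by rewrite /= mem_filter /= mem_head /= filter_uniq // enum_uniq.
have szL : (#|` D| - h <= size L)%N.
  have : (size (enum {: D}) <= size (L ++ [:: [` qD]%fset; [` rD]%fset]))%N.
    apply: uniq_leq_size => [|u _]; first exact: enum_uniq.
    rewrite mem_cat !inE mem_filter mem_enum /= andbT !inE -!val_eqE /=.
    by do 3!case: eqP.
  rewrite size_cat -cardE -cardfE /=; lia.
have t0 : (0 < #|` D| - h)%N by rewrite subn_gt0.
pose f : {ffun 'I_(#|` D| - h) -> D} := [ffun a : 'I__ => nth [` pD]%fset L a].
have fi : injectiveb f.
  apply/injectiveP => a b; rewrite !ffunE => /eqP.
  by rewrite nth_uniq ?(leq_trans (ltn_ord _)) // => /eqP/val_inj.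
pose c : config D h := exist _ f fi.
have posE a : pos c a = nth [` pD]%fset L a by rewrite /pos /= ffunE.
have hole u : u \in [:: q; r] -> u \notin tile_cells c.
  move=> uqr; apply/mapP => -[a _]; rewrite posE => ua.
  have : nth [` pD]%fset L a \in L by apply: mem_nth; rewrite (leq_trans _ szL).
  rewrite inE -val_eqE -ua mem_filter /= -ua !inE => /orP[/eqP e|].
    move: uqr; rewrite e !inE => /orP[] /eqP e'.
      by move: (hex_adj_neq pq); rewrite e' eqxx.
    by move: (hex_adj_neq pr); rewrite e' eqxx.
  by move: uqr; rewrite !inE => /orP[] /eqP->; rewrite eqxx ?orbT.
exists c; apply/existsP; exists (Ordinal t0); apply/existsP; exists [` qD]%fset.
rewrite /slide_permitted is_holeE posE /= hole ?mem_head // pq /=.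
apply/existsP; exists [` rD]%fset; rewrite is_holeE hole ?inE ?eqxx ?orbT //=.
rewrite hex_adjC pr hex_adjC qr !andbT.
by apply/eqP => /(congr1 val) /= e; move: (hex_adj_neq qr); rewrite e eqxx.
Qed.

Lemma mobile_maximally_connected (D : board) h p q r :
  mobile (mem D) -> (3 <= h)%N -> (h < #|` D|)%N ->
  p \in D -> q \in D -> r \in D -> tri p q r -> maximally_connected D h.
Proof.
move=> [B [uB BD _ sB]] h3 hD pD qD rD tr.
split; first exact: (non_isolated_exists h3 hD pD qD rD tr).
move=> c d /(three_holes_of h3 hD)[q1 [r1 [x1 [u1 ZD1 Zc1 qr1]]]].
move=> /(three_holes_of h3 hD)[q2 [r2 [x2 [u2 ZD2 Zc2 qr2]]]].
have ZB1 : {subset [:: q1; r1; x1] <= B} by move=> u /ZD1; rewrite BD.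
have ZB2 : {subset [:: q2; r2; x2] <= B} by move=> u /ZD2; rewrite BD.
have P1 := state_of_perm hD uB BD u1 erefl ZB1 Zc1.
have P2 := state_of_perm hD uB BD u2 erefl ZB2 Zc2.
apply: (reach_connect BD) (state_of_reads Zc1) (state_of_reads Zc2).
apply: sB.
- rewrite /three_holes (permP P1) !count_cat !count_nseq /= addn0.
  by rewrite count_map (eq_count (a2 := pred0)) ?count_pred0.
- by rewrite (permPl P1) perm_sym.
- by exists q1, r1; rewrite /state_of !ZB1 ?inE ?eqxx ?orbT.
- by exists q2, r2; rewrite /state_of !ZB2 ?inE ?eqxx ?orbT.
Qed.

Theorem corollary1p4 (h : nat) (hh : (3 <= h)%N) :
  (forall m : nat, (5 <= m)%N -> (h < #|` triangle m|)%N ->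
     maximally_connected (triangle m) h) /\
  (forall m : nat, (3 <= m)%N -> (h < #|` flower m|)%N ->
     maximally_connected (flower m) h).
Proof.
split=> m m_ge hm.
  apply: (@mobile_maximally_connected _ _ (0, 0) (1, 0) (1, 1)) => //;
    rewrite ?in_triangle; try lia.
  apply: mobile_eq (mobile_triangle (m - 4)) => -[i j].
  by rewrite /region /= in_triangle; lia.
apply: (@mobile_maximally_connected _ _ (0, 0) (1, 0) (1, 1)) => //;
  rewrite ?in_flower ?ge_max; try lia.
apply: mobile_eq (mobile_flower (m - 3)) => -[i j].
by rewrite /region /= in_flower !ge_max; lia.
Qed.
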